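(* Let $A$ be a symmetric nonnegative matrix of size $n\times n$, with $|A|_{\infty}\leq 1$, and with zero diagonal, such that $$\left\|A+\tfrac{1}{2}I_{n}\right\|_{*}+\left\|J_{n}-A-\tfrac{1}{2}I_{n}\right\|_{*}=n+(n-1)\sqrt{n}.$$ Then $A$ is the adjacency matrix of a conference graph.
   Context: Matrices are real, and nonnegative means entrywise nonnegative. $I_n$ is the $n\times n$ identity matrix and $J_n$ is the $n\times n$ all-ones matrix. $|A|_{\infty}$ is the maximum of the absolute values of the entries of $A$. The trace norm $\|A\|_{*}$ is the sum of the singular values of $A$. Graphs are finite, simple and undirected. A strongly regular graph with parameters $(n,d,\lambda,\mu)$ is a $d$-regular graph of order $n$ in which every two distinct adjacent vertices have exactly $\lambda$ common neighbours and every two distinct nonadjacent vertices have exactly $\mu$ common neighbours (a condition on pairs is vacuous if there are no such pairs). A conference graph of order $n$ is a strongly regular graph with parameters $\left(n,(n-1)/2,(n-5)/4,(n-1)/4\right)$. *)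

(* Defs.v *)
From mathcomp Require Import all_boot all_order all_algebra.
From mathcomp Require Import reals matrix_normedtype.
From mathcomp Require Import polyrcf.

Set Implicit Arguments.
Unset Strict Implicit.
Unset Printing Implicit Defensive.

Import Order.TTheory GRing.Theory Num.Theory.

Local Open Scope ring_scope.

(* The singular values of A, i.e. the square roots of the eigenvalues of      *)
(* A^T A, each listed according to its multiplicity as a root of the          *)
(* characteristic polynomial. [rootsR p] lists the roots of p <> 0 without    *)
(* repetition, and all the eigenvalues of A^T A are real.                     *)
Definition singular_values (R : realType) (n : nat) (A : 'M[R]_n) : seq R :=
  let p := char_poly (A^T *m A) in
  flatten [seq nseq (mup x p) (Num.sqrt x) | x <- rootsR p].

Definition trace_norm (R : realType) (n : nat) (A : 'M[R]_n) : R :=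
  \sum_(s <- singular_values A) s.

Definition simple_graph (T : finType) (e : rel T) : Prop :=
  symmetric e /\ irreflexive e.

Definition common_neighbours (T : finType) (e : rel T) (x y : T) : {set T} :=
  [set z | e x z && e y z].

(* The parameters are rational, not natural, numbers: those of a conference   *)
(* graph are given by exact fractions, and (n - 5) / 4 = -1 when n = 1.       *)
Record strongly_regular (T : finType) (e : rel T)
    (n : nat) (d lambda mu : rat) : Prop := StronglyRegular {
  srg_simple : simple_graph e;
  srg_order : #|T| = n;
  srg_regular : forall x, #|[set y | e x y]|%:R = d;
  srg_adjacent : forall x y, x != y -> e x y ->
    #|common_neighbours e x y|%:R = lambda;
  srg_nonadjacent : forall x y, x != y -> ~~ e x y ->
    #|common_neighbours e x y|%:R = mu }.

Definition conference_graph (T : finType) (e : rel T) (n : nat) : Prop :=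
  strongly_regular e n
    ((n%:R - 1) / 2) ((n%:R - 5) / 4) ((n%:R - 1) / 4).

Definition adjacency_mx (R : realType) (n : nat) (e : rel 'I_n) : 'M[R]_n :=
  \matrix_(i, j) (e i j)%:R.

(* Main.v *)
Require Import Defs.
From mathcomp Require Import all_boot all_order all_algebra.
From mathcomp Require Import reals matrix_normedtype.
From mathcomp Require Import polyrcf complex spectral ring lra.

(** Put B = A + I/2, C = J - B and H = B - C = 2A + I - J, and let P = J/n be
    the orthogonal projection onto the all-ones vector, Q = I - P.

    The trace norm of B is the trace of a symmetric S with S^2 = B^T B
    ([trace_norm_symmetric_sqrt]).  For a, c > 0, the squared Frobenius norms
    of (S - c)Q and (S - a)P, combined with weights 1 and c/a, give
      2c ||B||_* <= tr(B^T B) - (1 - c/a) tr(B^T B P) + c^2 tr Q + ca tr P,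
    and equality forces SQ = cQ and SP = aP, hence B^T B = c^2 Q + a^2 P
    ([projection_gap_ge0], [projection_gap_eq0]).

    For the adjacency matrix of a conference graph, B and C have the singular
    value n/2 on the all-ones vector and sqrt(n)/2 on its orthogonal, so the
    choice a = n/2, c = sqrt(n)/2 loses nothing there.  Adding the two
    inequalities for an arbitrary A, the traces satisfy
      tr(B^T B) + tr(C^T C) = n^2 - n/2 - 2 sum_ij A_ij (1 - A_ij),
      tr(B^T B P) + tr(C^T C P) = (n^2 + |HP|^2) / 2,
    so ||B||_* + ||C||_* <= n + (n - 1) sqrt(n), with a deficit to which the
    terms A_ij (1 - A_ij) and the slacks of the two inequalities contribute
    nonnegatively.  The hypothesis says that the deficit is zero, so each of
    them vanishes ([extremal_gram]): the entries of A are 0 or 1, and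
    B^T B = C^T C = (n/4) Q + (n^2/4) P.  The parallelogram identity then gives
    H^2 = nI - J, whence HJ = 0, and in terms of A this reads
    AJ = ((n - 1)/2) J and A^2 + A = ((n - 1)/4) (I + J), which are the
    defining counts of a conference graph ([conference_graph_adjacency]). *)

Import Order.TTheory GRing.Theory Num.Theory.

Local Open Scope ring_scope.

(** * Gram matrices *)

Lemma mxtrace_gram {R : realDomainType} {m n : nat} (X : 'M[R]_(m, n)) :
  \tr (X^T *m X) = \sum_j \sum_i X i j ^+ 2.
Proof.
by apply: eq_bigr => j _; rewrite mxE; apply: eq_bigr => i _; rewrite mxE expr2.
Qed.

Lemma mxtrace_gram_ge0 {R : realDomainType} {m n : nat} (X : 'M[R]_(m, n)) :
  0 <= \tr (X^T *m X).
Proof.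
by rewrite mxtrace_gram; do 2!apply: sumr_ge0 => ? _; rewrite sqr_ge0.
Qed.

Lemma mxtrace_gram_eq0 {R : realDomainType} {m n : nat} (X : 'M[R]_(m, n)) :
  \tr (X^T *m X) = 0 -> X = 0.
Proof.
rewrite mxtrace_gram => /eqP; rewrite psumr_eq0 => [/allP X0|j _]; last first.
  by apply: sumr_ge0 => i _; rewrite sqr_ge0.
apply/matrixP => i j; rewrite mxE.
have := X0 j (mem_index_enum j); rewrite psumr_eq0 => [|k _]; last first.
  by rewrite sqr_ge0.
by move=> /allP/(_ i (mem_index_enum i)); rewrite sqrf_eq0 => /eqP.
Qed.

Lemma gram_parallelogram {R : comPzRingType} {m n : nat} (B C : 'M[R]_(m, n)) :
  (B + C)^T *m (B + C) + (B - C)^T *m (B - C)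
    = 2 *: (B^T *m B + C^T *m C).
Proof.
have trD (X Y : 'M[R]_(m, n)) : (X + Y)^T = X^T + Y^T by rewrite raddfD.
have trN (X : 'M[R]_(m, n)) : (- X)^T = - X^T by rewrite raddfN.
rewrite !trD trN !mulmxDl !mulmxDr !mulNmx !mulmxN opprK.
rewrite scaler_nat mulr2n.
move: (B^T *m B) (B^T *m C) (C^T *m B) (C^T *m C) => a b c d.
by apply/matrixP => i j; rewrite !mxE; ring.
Qed.

Lemma mulmx_const1 {R : pzSemiRingType} {m n p : nat} :
  (const_mx 1 : 'M[R]_(m, n)) *m (const_mx 1 : 'M[R]_(n, p))
    = n%:R *: const_mx 1.
Proof.
apply/matrixP => i j; rewrite !mxE mulr1.
under eq_bigr do rewrite !mxE mulr1.
by rewrite sumr_const card_ord.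
Qed.

(** * The trace norm as the trace of a symmetric square root *)

Lemma trace_norm_char_poly {R : realType} {n : nat} (B : 'M[R]_n) (s : seq R) :
  char_poly (B^T *m B) = \prod_(x <- s) ('X - x%:P) ->
  trace_norm B = \sum_(x <- s) Num.sqrt x.
Proof.
move=> charE; rewrite /trace_norm /singular_values charE.
have mon : \prod_(x <- s) ('X - x%:P) \is monic by exact: monic_prod_XsubC.
have rootsE : perm_eq (rootsR (\prod_(x <- s) ('X - x%:P))) (undup s).
  apply: uniq_perm; rewrite ?undup_uniq ?uniq_roots // => x.
  rewrite mem_undup -[RHS]root_prod_XsubC.
  exact: esym (roots_on_rootsR (monic_neq0 mon) x).
rewrite big_flatten big_map (perm_big _ rootsE) /=.
rewrite -(big_undup_iterop_count _ s xpredT Num.sqrt) /=.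
apply: eq_bigr => x _; rewrite mu_prod_XsubC big_nseq.
by rewrite Monoid.iteropE.
Qed.

Lemma char_poly_similar {R : fieldType} {n : nat} (Q M D : 'M[R]_n) :
  Q \in unitmx -> Q *m M = D *m Q -> char_poly M = char_poly D.
Proof.
move=> Qunit QMDQ; pose Qp := map_mx polyC Q.
have Qp_neq0 : \det Qp != 0.
  by rewrite det_map_mx polyC_eq0 -unitfE -unitmxE.
apply: (mulfI Qp_neq0); rewrite [RHS]mulrC /char_poly -!det_mulmx.
rewrite /char_poly_mx mulmxBr mulmxBl -!map_mxM QMDQ.
by rewrite scalar_mxC.
Qed.

(** The spectral theorem over the complex numbers gives a unitary change of
    basis with real eigenvalues.  Two real matrices that are similar over the
    complex numbers are similar over the reals, at the price of orthogonality:
    Q is merely invertible. *)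
Lemma symmetric_diagonalizable {R : rcfType} {n : nat} (M : 'M[R]_n) :
  M^T = M ->
  exists Q : 'M[R]_n, exists2 d : 'rV[R]_n,
    Q \in unitmx & Q *m M = diag_mx d *m Q.
Proof.
move=> Msym; pose toC := [the {rmorphism R -> R[i]} of real_complex R].
have realC m p (X : 'M[R]_(m, p)) : map_mx toC X \is a mxOver Num.real.
  by apply/mxOverP => i j; rewrite mxE; apply/complex_realP; exists (X i j).
have ReK m p (X : 'M[R[i]]_(m, p)) : X \is a mxOver Num.real ->
    exists Y : 'M[R]_(m, p), X = map_mx toC Y.
  move=> /mxOverP Xreal; exists (map_mx (@complex.Re R) X).
  by apply/matrixP => i j; rewrite !mxE [RHS]RRe_real.
pose MC := map_mx toC M.
have MCherm : MC \is hermsymmx.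
  apply: realsym_hermsym; last exact: realC.
  by apply/is_hermitianmxP; rewrite expr0 scale1r map_mx_id // map_trmx Msym.
have [d dE] := ReK _ _ _ (hermitian_spectral_diag_real MCherm).
have /orthomx_spectralP specE := hermitian_normalmx MCherm.
have Punit := spectral_unit MC.
have [|||P] := @real_similar _ _ MC (map_mx toC (diag_mx d)).
- exists (spectralmx MC) => //; apply/similarP => //.
  by rewrite map_diag_mx -dE {2}specE !mulmxA mulmxV // mul1mx.
- exact: realC.
- exact: realC.
rewrite inE => /andP[/ReK[Q ->] QCunit] /(similarP QCunit).
rewrite -!map_mxM => /map_mx_inj QM.
by exists Q; exists d => //; rewrite -(map_unitmx toC).
Qed.

(** Commuting with a diagonal matrix is a condition on its equal entries, so it
    survives applying any function to these entries. *)
Lemma diag_mx_comm_map {R : idomainType} {n : nat} (f : R -> R)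
    (d : 'rV[R]_n) (G : 'M[R]_n) :
  diag_mx d *m G = G *m diag_mx d ->
  diag_mx (map_mx f d) *m G = G *m diag_mx (map_mx f d).
Proof.
move=> comm; apply/matrixP => i j; move/matrixP/(_ i j): comm.
rewrite !mul_diag_mx !mul_mx_diag !mxE (mulrC (G i j)) => /eqP.
rewrite -subr_eq0 -mulrBl mulf_eq0 subr_eq0 => /orP[/eqP->|/eqP->].
  by rewrite mulrC.
by rewrite mulr0 mul0r.
Qed.

(** With B^T B = Q^-1 D Q, the matrix S is Q^-1 D^(1/2) Q.  The base change Q
    need not be orthogonal, but symmetry of B^T B means that D commutes with
    Q Q^T; then so does D^(1/2), which means that S is symmetric. *)
Lemma trace_norm_symmetric_sqrt {R : realType} {n : nat} (B : 'M[R]_n) :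
  exists S : 'M[R]_n,
    [/\ S^T = S, S *m S = B^T *m B & \tr S = trace_norm B].
Proof.
set M := B^T *m B.
have Msym : M^T = M by rewrite trmx_mul trmxK.
have [Q [d Qunit QM]] := symmetric_diagonalizable _ Msym.
(* A row q of Q is an eigenvector, and d_i |q|^2 = |B q^T|^2. *)
have d_ge0 i : 0 <= d 0 i.
  pose q := row i Q.
  have q_neq0 : q != 0.
    apply: contraTneq Qunit => q0; rewrite -row_free_unit; apply/negP => Qfree.
    suff /eqP : delta_mx 0 i = 0 :> 'rV[R]_n.
      by move=> /eqP/rowP/(_ i)/eqP; rewrite !mxE !eqxx oner_eq0.
    by apply: (row_free_inj Qfree); rewrite -rowE mul0mx.
  have qM : q *m M = d 0 i *: q.
    by rewrite /q -row_mul QM row_mul row_diag_mx -scalemxAl -rowE.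
  have qTq_gt0 : 0 < \tr (q^T^T *m q^T).
    rewrite lt_def mxtrace_gram_ge0 andbT; apply: contraNneq q_neq0.
    by move=> /mxtrace_gram_eq0/(congr1 trmx)/eqP; rewrite trmxK trmx0.
  rewrite -(pmulr_lge0 _ qTq_gt0) -mxtraceZ trmxK scalemxAl -qM -!mulmxA.
  have := mxtrace_gram_ge0 (B *m q^T).
  by rewrite trmx_mul trmxK /M -!mulmxA.
pose D' := diag_mx (map_mx Num.sqrt d).
have sqrtD : D' *m D' = diag_mx d.
  rewrite mulmx_diag; congr diag_mx; apply/rowP => i.
  by rewrite !mxE -expr2 sqr_sqrtr.
exists (invmx Q *m D' *m Q).
have MQ : M = invmx Q *m diag_mx d *m Q by rewrite -mulmxA -QM mulKmx.
split.
- set G := Q *m Q^T.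
  have comm : diag_mx d *m G = G *m diag_mx d.
    rewrite /G mulmxA -QM -mulmxA -[in LHS]Msym -trmx_mul QM trmx_mul.
    by rewrite tr_diag_mx mulmxA.
  have comm' := diag_mx_comm_map Num.sqrt _ _ comm.
  rewrite !trmx_mul tr_diag_mx.
  apply: (can_inj (mulKmx Qunit)); rewrite !mulmxA mulmxV // mul1mx.
  by rewrite -/G -comm' /G -!mulmxA -trmx_mul mulVmx // trmx1 mulmx1.
- rewrite MQ -sqrtD !mulmxA.
  by rewrite -[invmx Q *m D' *m Q *m invmx Q]mulmxA mulmxV // mulmx1.
- rewrite mxtrace_mulC mulmxA mulmxV // mul1mx mxtrace_diag.
  rewrite (trace_norm_char_poly _ [seq d 0 i | i <- enum 'I_n]).
    by rewrite big_map big_enum; apply: eq_bigr => i _; rewrite mxE.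
  rewrite (char_poly_similar _ _ _ Qunit QM) char_poly_trig ?diag_mx_is_trig //.
  rewrite big_map big_enum; apply: eq_bigr => i _.
  by rewrite !mxE eqxx mulr1n.
Qed.

(** * An upper bound on the trace norm relative to a projection *)

Lemma mxtrace_gram_shift {R : comPzRingType} {n : nat} (S E : 'M[R]_n) (t : R) :
  S^T = S -> E^T = E -> E *m E = E ->
  \tr ((S *m E - t *: E)^T *m (S *m E - t *: E))
    = \tr (S *m S *m E) - 2 * t * \tr (S *m E) + t ^+ 2 * \tr E.
Proof.
move=> Ssym Esym Eidem.
have trE (X : 'M[R]_n) : \tr (E *m X *m E) = \tr (X *m E).
  by rewrite mxtrace_mulC mulmxA Eidem mxtrace_mulC.
have -> : (S *m E - t *: E)^T *m (S *m E - t *: E)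
    = E *m (S *m S) *m E - (2 * t) *: (E *m S *m E) + t ^+ 2 *: E.
  have -> : (S *m E - t *: E)^T = E *m S - t *: E.
    by rewrite raddfB /= linearZ /= trmx_mul Ssym Esym.
  rewrite mulmxBl !mulmxBr.
  rewrite -!scalemxAl -!scalemxAr !mulmxA -(mulmxA (E *m S)) Eidem.
  by rewrite scalerA -expr2 mulr_natl mulr2n scalerDl !opprD opprK !addrA.
by rewrite mxtraceD raddfB /= !mxtraceZ !trE.
Qed.

(** This is 2c times the amount by which the trace norm of B falls short of an
    upper bound, which is exact when B^T B has the eigenvalue a^2 on the range
    of P and c^2 on its orthogonal. *)
Definition projection_gap {R : realType} {n : nat} (B P : 'M[R]_n) (a c : R) :=
  \tr (B^T *m B) - (1 - c / a) * \tr (B^T *m B *m P)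
  + c ^+ 2 * \tr (1%:M - P) + c * a * \tr P - 2 * c * trace_norm B.

(** The weight c / a on the second square makes the coefficients of tr(SQ) and
    tr(SP) equal, so that only the trace of S remains. *)
Lemma projection_gapE {R : realType} {n : nat} (B P S : 'M[R]_n) (a c : R)
    (Q := 1%:M - P) (X := S *m Q - c *: Q) (Y := S *m P - a *: P) :
  S^T = S -> S *m S = B^T *m B -> \tr S = trace_norm B ->
  P^T = P -> P *m P = P -> a != 0 ->
  projection_gap B P a c = \tr (X^T *m X) + c / a * \tr (Y^T *m Y).
Proof.
move=> Ssym SS trS Psym Pidem a_neq0.
have Qsym : Q^T = Q by rewrite raddfB /= trmx1 Psym.
have Qidem : Q *m Q = Q.
  by rewrite mulmxBr mulmx1 mulmxBl mul1mx Pidem subrr subr0.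
have trQP (Z : 'M[R]_n) : \tr Z = \tr (Z *m Q) + \tr (Z *m P).
  by rewrite -mxtraceD -mulmxDr subrK mulmx1.
rewrite /projection_gap !mxtrace_gram_shift //.
by rewrite -trS -SS (trQP (S *m S)) (trQP S) -/Q; field.
Qed.

Lemma projection_gap_ge0 {R : realType} {n : nat} (B P : 'M[R]_n) (a c : R) :
  P^T = P -> P *m P = P -> 0 < a -> 0 < c -> 0 <= projection_gap B P a c.
Proof.
move=> Psym Pidem a_gt0 c_gt0.
have [S [Ssym SS trS]] := trace_norm_symmetric_sqrt B.
rewrite (projection_gapE _ _ S) ?lt0r_neq0 // addr_ge0 ?mxtrace_gram_ge0 //.
by rewrite mulr_ge0 ?mxtrace_gram_ge0 // divr_ge0 // ltW.
Qed.

Lemma projection_gap_eq0 {R : realType} {n : nat} (B P : 'M[R]_n) (a c : R) :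
  P^T = P -> P *m P = P -> 0 < a -> 0 < c -> projection_gap B P a c = 0 ->
  B^T *m B = c ^+ 2 *: (1%:M - P) + a ^+ 2 *: P.
Proof.
move=> Psym Pidem a_gt0 c_gt0.
have [S [Ssym SS trS]] := trace_norm_symmetric_sqrt B.
have ca_gt0 : 0 < c / a by rewrite divr_gt0.
rewrite (projection_gapE _ _ S) ?lt0r_neq0 // => /eqP.
rewrite paddr_eq0 ?mxtrace_gram_ge0 ?(mulr_ge0 (ltW _)) ?mxtrace_gram_ge0 //.
rewrite (mulrI_eq0 _ (mulfI (lt0r_neq0 ca_gt0))).
move=> /andP[/eqP/mxtrace_gram_eq0/subr0_eq SQ].
move=> /eqP/mxtrace_gram_eq0/subr0_eq SP.
have SE : S = c *: (1%:M - P) + a *: P.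
  by rewrite -SQ -SP -mulmxDr subrK mulmx1.
by rewrite -SS {2}SE mulmxDr -!scalemxAr SQ SP !scalerA !expr2.
Qed.

(** * A matrix and its complement *)

(** Off the diagonal x^2 + (1 - x)^2 = 1 - 2 x (1 - x), while the two diagonal
    entries are both 1/2. *)
Lemma mxtrace_gram_complement {R : realFieldType} {n : nat} (A : 'M[R]_n)
    (B := A + (1 / 2)%:M) (C := const_mx 1 - A - (1 / 2)%:M) :
  (forall i, A i i = 0) ->
  \tr (B^T *m B) + \tr (C^T *m C)
    = n%:R ^+ 2 - n%:R / 2 - 2 * \sum_i \sum_j A i j * (1 - A i j).
Proof.
move=> A_diag0; rewrite !mxtrace_gram -big_split /=.
transitivity
  (\sum_(j < n) (n%:R - 1 / 2 - 2 * \sum_(i < n) A i j * (1 - A i j))).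
  apply: eq_bigr => j _; rewrite -big_split /=.
  transitivity
    (\sum_(i < n) (1 - (i == j)%:R / 2 - 2 * (A i j * (1 - A i j)))).
    apply: eq_bigr => i _; rewrite !mxE.
    case: eqVneq => [->|_]; first by rewrite A_diag0 /= mulr1n; field.
    by rewrite /= !mulr0n; field.
  rewrite !sumrB -mulr_sumr -mulr_suml sumr_const card_ord.
  by rewrite (bigD1 j) //= eqxx big1 ?addr0 // => i /negbTE->.
rewrite sumrB sumr_const card_ord -[_ *+ n]mulr_natr -mulr_sumr.
by rewrite exchange_big /=; field.
Qed.

Lemma mxtrace_gram_projection {R : numFieldType} {n : nat} (B C P : 'M[R]_n) :
  P^T = P -> P *m P = P ->
  \tr (B^T *m B *m P) + \tr (C^T *m C *m P)
    = (\tr ((B + C)^T *m (B + C) *m P)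
       + \tr (((B - C) *m P)^T *m ((B - C) *m P))) / 2.
Proof.
move=> PT PP; have := gram_parallelogram B C.
move: (B + C) (B - C) => K H /(congr1 (fun X => \tr (X *m P))).
rewrite mulmxDl mxtraceD -scalemxAl mxtraceZ mulmxDl mxtraceD.
have -> : \tr ((H *m P)^T *m (H *m P)) = \tr (H^T *m H *m P).
  by rewrite trmx_mul PT -[P *m _ *m _]mulmxA mxtrace_mulC -!mulmxA PP.
by move=> ->; field.
Qed.

(** * Conference graphs *)

Lemma conference_graph_adjacency {R : numFieldType} {n : nat} (e : rel 'I_n) :
  let A : 'M[R]_n := \matrix_(i, j) (e i j)%:R in
  A^T = A -> (forall i, A i i = 0) ->
  A *m const_mx 1 = ((n%:R - 1) / 2) *: (const_mx 1 : 'M[R]_n) ->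
  A *m A + A = ((n%:R - 1) / 4) *: (1%:M + const_mx 1) ->
  conference_graph e n.
Proof.
move=> A Asym Adiag AJ AA.
have e_sym : symmetric e.
  move=> x y; have /matrixP/(_ x y) := Asym; rewrite !mxE => /eqP.
  by rewrite eqr_nat; case: (e x y); case: (e y x).
have e_irr : irreflexive e.
  move=> x; have := Adiag x; rewrite mxE.
  by case: (e x x) => // /eqP; rewrite oner_eq0.
have degE x : (#|[set y | e x y]|%:R : R) = (n%:R - 1) / 2.
  have /matrixP/(_ x x) := AJ; rewrite !mxE mulr1 => <-.
  rewrite -sum1_card natr_sum [LHS]big_mkcond /=; apply: eq_bigr => y _.
  by rewrite !mxE inE mulr1; case: (e x y).
have codegE x y : x != y ->
    (#|common_neighbours e x y|%:R : R) = (n%:R - 1) / 4 - (e x y)%:R.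
  move=> xy; have /matrixP/(_ x y) := AA; rewrite !mxE (negbTE xy) add0r mulr1.
  move=> /(canRL (addrK _)) <-.
  rewrite -sum1_card natr_sum [LHS]big_mkcond /=; apply: eq_bigr => z _.
  rewrite !mxE inE (e_sym z y).
  by case: (e x z); case: (e y z); rewrite /= ?mulr1 ?mulr0.
(* The counts are found in R, but the parameters of the graph are rational. *)
have toQ (q : rat) k : (k%:R : R) = ratr q -> k%:R = q.
  by rewrite -(ratr_nat R) => /fmorph_inj.
split=> //; first by rewrite card_ord.
- move=> x; apply: toQ.
  by rewrite degE rmorphM fmorphV rmorphB rmorph1 !rmorph_nat.
- move=> x y xy exy; apply: toQ; rewrite codegE // exy /=.
  by rewrite rmorphM fmorphV rmorphB !rmorph_nat; field.
- move=> x y xy /negbTE exy; apply: toQ; rewrite codegE // exy subr0.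
  by rewrite rmorphM fmorphV rmorphB rmorph1 !rmorph_nat.
Qed.

(** Here - H is the Seidel matrix of A.  Its relations with J are transported
    to A = (H + J - I) / 2. *)
Lemma adjacency_equations {R : numFieldType} {n : nat} (A : 'M[R]_n)
    (J := const_mx 1 : 'M[R]_n) (H := 2 *: A + 1%:M - J) :
  H *m H = n%:R *: 1%:M - J -> H *m J = 0 -> J *m H = 0 ->
  A *m J = ((n%:R - 1) / 2) *: J /\
  A *m A + A = ((n%:R - 1) / 4) *: (1%:M + J).
Proof.
move=> HH HJ JH.
have JJ : J *m J = n%:R *: J by exact: mulmx_const1.
have AE : A = 2^-1 *: (H + J - 1%:M).
  by apply/matrixP => i j; rewrite !mxE; field.
clearbody H J; split.
  rewrite AE -scalemxAl mulmxBl mulmxDl HJ JJ mul1mx.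
  by apply/matrixP => i j; rewrite !mxE; field.
rewrite AE -scalemxAl -scalemxAr !mulmxBl !mulmxBr !mulmxDl !mulmxDr.
rewrite !mul1mx !mulmx1 HH HJ JH JJ.
by apply/matrixP => i j; rewrite !mxE; field.
Qed.

(** * The extremal matrices *)

Lemma sum4_ge0_eq0 {R : realFieldType} (z h x y : R) :
  0 <= z -> 0 <= h -> 0 <= x -> 0 <= y ->
  2 * z + h + x + y = 0 -> [/\ z = 0, x = 0 & y = 0].
Proof. by move=> *; split; lra. Qed.

(** With z = sum_ij A_ij (1 - A_ij) and h = |(B - C) P|^2, the sum of 2 z,
    (1 - 1 / sqrt n) h / 2 and the two gaps is sqrt n times the difference
    between n + (n - 1) sqrt n and the sum of the trace norms, which is zero
    here; and all four terms are nonnegative. *)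
Lemma extremal_gram {R : realType} {n : nat} (A : 'M[R]_n)
    (J := const_mx 1 : 'M[R]_n) (P := n%:R^-1 *: J)
    (B := A + (1 / 2)%:M) (C := J - A - (1 / 2)%:M) :
  (0 < n)%N -> (forall i j, 0 <= A i j * (1 - A i j)) ->
  (forall i, A i i = 0) ->
  trace_norm B + trace_norm C = n%:R + (n%:R - 1) * Num.sqrt n%:R ->
  let G := (n%:R / 4) *: (1%:M - P) + (n%:R / 2) ^+ 2 *: P in
  [/\ forall i j, A i j * (1 - A i j) = 0, B^T *m B = G & C^T *m C = G].
Proof.
move=> n_gt0 A_itv A_diag0; set r := Num.sqrt n%:R => A_norms G.
have nR_gt0 : 0 < n%:R :> R by rewrite ltr0n.
have r2 : r ^+ 2 = n%:R by rewrite sqr_sqrtr // ltW.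
have r_gt0 : 0 < r by rewrite sqrtr_gt0.
have r_neq0 : r != 0 by rewrite gt_eqF.
have r_ge1 : 1 <= r by rewrite -sqrtr1 ler_sqrt // ler1n.
have JJ : J *m J = n%:R *: J by exact: mulmx_const1.
have PT : P^T = P by rewrite linearZ /= trmx_const.
have PP : P *m P = P.
  by rewrite -scalemxAl -scalemxAr JJ !scalerA mulfVK // lt0r_neq0.
have trP : \tr P = 1.
  rewrite mxtraceZ /mxtrace (eq_bigr (fun=> 1)) => [|i _]; last by rewrite mxE.
  by rewrite sumr_const card_ord mulVf // lt0r_neq0.
have trQ : \tr (1%:M - P) = n%:R - 1 by rewrite raddfB /= mxtrace1 trP.
(* The singular values that a conference graph gives to B and C. *)
have a_gt0 : 0 < n%:R / 2 :> R by rewrite divr_gt0.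
have c_gt0 : 0 < r / 2 by rewrite divr_gt0.
have gapE X : projection_gap X P (n%:R / 2) (r / 2)
    = \tr (X^T *m X) - (1 - r^-1) * \tr (X^T *m X *m P)
      + n%:R / 4 * (n%:R - 1) + r * n%:R / 4 - r * trace_norm X.
  rewrite /projection_gap trP trQ -r2.
  by move: (\tr _) (\tr _) (trace_norm X) => x y t; field.
pose z := \sum_i \sum_j A i j * (1 - A i j).
pose h := \tr (((B - C) *m P)^T *m ((B - C) *m P)).
have trE : \tr (B^T *m B) + \tr (C^T *m C) = n%:R ^+ 2 - n%:R / 2 - 2 * z.
  exact: mxtrace_gram_complement.
have trPE :
    \tr (B^T *m B *m P) + \tr (C^T *m C *m P) = (n%:R ^+ 2 + h) / 2.
  rewrite mxtrace_gram_projection // -/h; congr ((_ + _) / _).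
  have CE : C = J - B by rewrite /C /B opprD addrA.
  have -> : B + C = J by rewrite CE addrCA subrr addr0.
  rewrite trmx_const -/J JJ -scalemxAl -scalemxAr JJ mxtraceZ.
  rewrite [in X in _ * X]scalerA mulVf ?lt0r_neq0 // scale1r.
  rewrite /mxtrace (eq_bigr (fun=> 1)) => [|i _]; last by rewrite mxE.
  by rewrite sumr_const card_ord expr2.
have z_ge0 : 0 <= z by do 2!apply: sumr_ge0 => ? _.
have h_ge0 : 0 <= (1 - r^-1) * (h / 2).
  by rewrite mulr_ge0 ?divr_ge0 ?mxtrace_gram_ge0 // subr_ge0 invf_le1.
have : 2 * z + (1 - r^-1) * (h / 2) + projection_gap B P (n%:R / 2) (r / 2)
    + projection_gap C P (n%:R / 2) (r / 2) = 0.
  rewrite !gapE; move: A_norms trE trPE.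
  move: (\tr (B^T *m B)) (\tr (C^T *m C)) (\tr (B^T *m B *m P))
    (\tr (C^T *m C *m P)) (trace_norm B) (trace_norm C) z h {z_ge0 h_ge0}.
  move=> x x' y y' t t' z h /(canRL (addrK _))-> /(canRL (addrK _))->.
  by move=> /(canRL (addrK _))->; rewrite -r2; field.
have gapB := projection_gap_ge0 B P _ _ PT PP a_gt0 c_gt0.
have gapC := projection_gap_ge0 C P _ _ PT PP a_gt0 c_gt0.
case/(sum4_ge0_eq0 _ _ _ _ z_ge0 h_ge0 gapB gapC) => z0 gapB0 gapC0.
have c2 : (r / 2) ^+ 2 = n%:R / 4 by rewrite -r2; field.
split; last 2 first.
- by rewrite /G -c2; exact: (projection_gap_eq0 B P).
- by rewrite /G -c2; exact: (projection_gap_eq0 C P).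
move=> i j; apply/eqP; move/eqP: z0.
rewrite psumr_eq0 => [/allP/(_ i (mem_index_enum i))|k _]; last first.
  exact: sumr_ge0.
by rewrite psumr_eq0 // => /allP/(_ j (mem_index_enum j)).
Qed.

Theorem corollary4 (R : realType) (n : nat) (A : 'M[R]_n)
  (A_sym : A^T = A)
  (A_ge0 : forall i j : 'I_n, 0 <= A i j)
  (A_le1 : mx_norm A <= 1)
  (A_diag0 : forall i : 'I_n, A i i = 0)
  (A_norms : trace_norm (A + (1 / 2)%:M)
               + trace_norm (const_mx 1 - A - (1 / 2)%:M)
             = n%:R + (n%:R - 1) * Num.sqrt n%:R) :
  exists e : rel 'I_n, conference_graph e n /\ A = adjacency_mx R e.
Proof.
(* The projection J / n needs n > 0; the empty graph is a conference graph. *)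
have [n0|n_gt0] := posnP n.
  exists (fun _ _ => false); split; last first.
    by apply/matrixP => i; have := ltn_ord i; rewrite {2}n0.
  split=> //; try by move=> i; have := ltn_ord i; rewrite {2}n0.
  by rewrite card_ord.
have A_itv i j : 0 <= A i j * (1 - A i j).
  rewrite mulr_ge0 // subr_ge0 -[A i j]ger0_norm //; apply: le_trans A_le1.
  by rewrite mx_normrE (le_bigmax _ _ (i, j)).
have [A01 BB CC] := extremal_gram A n_gt0 A_itv A_diag0 A_norms.
move: BB CC; set J := const_mx 1; set B := A + _; set C := J - A - _.
set P := n%:R^-1 *: J => BB CC.
have nR_neq0 : n%:R != 0 :> R by rewrite pnatr_eq0 -lt0n.
have JT : J^T = J by rewrite trmx_const.
have JJ : J *m J = n%:R *: J by exact: mulmx_const1.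
have nP : n%:R *: P = J by rewrite scalerA divff // scale1r.
set H := 2 *: A + 1%:M - J.
have HT : H^T = H by rewrite !raddfB raddfD /= linearZ /= A_sym trmx1 JT.
have BC_sum : B + C = J.
  have CE : C = J - B by rewrite /C /B opprD addrA.
  by rewrite CE addrCA subrr addr0.
have BC_diff : B - C = H.
  apply/matrixP => i j; rewrite !mxE.
  by case: (i == j); rewrite /= ?mulr1n ?mulr0n; field.
have HH : H *m H = n%:R *: 1%:M - J.
  have := gram_parallelogram B C.
  rewrite BC_sum BC_diff BB CC JT JJ HT => /(canRL (addKr _)) ->.
  by rewrite -nP; apply/matrixP => i j; rewrite !mxE; field.
(* The all-ones vector is in the kernel of H^2, hence in that of H. *)
have HJ : H *m J = 0.
  apply: mxtrace_gram_eq0.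
  rewrite trmx_mul HT JT !mulmxA -(mulmxA J H) HH mulmxBr -scalemxAr mulmx1.
  by rewrite JJ subrr mul0mx mxtrace0.
have JH : J *m H = 0 by rewrite -[LHS]trmxK trmx_mul HT JT HJ trmx0.
have [AJ AA] := adjacency_equations A HH HJ JH.
pose e : rel 'I_n := fun i j => A i j == 1.
have Ae : A = adjacency_mx R e.
  apply/matrixP => i j; rewrite mxE /e; have [->//|Aij] := eqVneq (A i j) 1.
  move/eqP: (A01 i j).
  by rewrite mulf_eq0 subr_eq0 (eq_sym 1) (negbTE Aij) orbF => /eqP.
exists e; split=> //.
by apply: (@conference_graph_adjacency R); rewrite -/(adjacency_mx R e) -Ae.
Qed.
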